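(* Let $t\ge 0$ be an integer and let $\epsilon\in\mathbb{R}$ satisfy $0<\epsilon\ll 1$. There exists a digraph $G$ with nonnegative edge costs on $\nu=\nu(t,\epsilon)=\Theta(t/\epsilon)$ vertices such that, for the metric completion $H$ of $G$, the integrality ratio of the level-$t$ Sherali–Adams tightening of the balanced LP relaxation of ATSP on $H$ is at least $1+\frac{1-\epsilon}{2t+3}$.
   Context: Metric completion: for a digraph $G=(V,E)$ with nonnegative edge costs $c$, its metric completion is the complete digraph $H$ on $V$ in which the cost $c'(v,w)$ of edge $(v,w)$ is the minimum $c$-cost of a $v$–$w$ dipath in $G$. Balanced LP of ATSP on a complete digraph $H=(V,E_H)$: variables $x_e$, $e\in E_H$; minimize $\sum_e c'_e x_e$ subject to $x(\delta^{in}(S))\ge 1$ and $x(\delta^{out}(S))\ge 1$ for all $\emptyset\subsetneq S\subsetneq V$, $x(\delta^{out}(\{v\}))=x(\delta^{in}(\{v\}))$ for all $v\in V$, and $0\le x\le 1$. Here $\delta^{out}(U)$ ($\delta^{in}(U)$) is the set of edges leaving (entering) $U$ and $x(F)=\sum_{e\in F}x_e$. Let $\hat P$ denote its feasible polytope. Sherali–Adams: let $\hat P\subseteq[0,1]^n$ be a polytope given by a finite system of linear inequalities $\sum_{i=1}^n a_i y_i\ge b$ (the system includes $0\le y_i\le 1$ for all $i$; equations are written as two inequalities). For an integer $t\ge0$, the level-$t$ Sherali–Adams tightening $SA^t(\hat P)$ is the set of vectors $y=(y_S)$ indexed by subsets $S\subseteq\{1,\dots,n\}$ with $|S|\le t+1$,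 with $y_\emptyset=1$, such that for every inequality $\sum_i a_i y_i\ge b$ of the system and every pair of disjoint sets $S,Q\subseteq\{1,\dots,n\}$ with $|S|+|Q|\le t$: $\sum_{i=1}^n a_i\sum_{T\subseteq Q}(-1)^{|T|}y_{S\cup T\cup\{i\}}\ \ge\ b\sum_{T\subseteq Q}(-1)^{|T|}y_{S\cup T}$. Integrality ratio of the instance: the minimum cost of a Hamiltonian dicycle in $H$ (w.r.t. $c'$) divided by $\min\{\sum_{e}c'_e\,y_{\{e\}} : y\in SA^t(\hat P)\}$. *)

(* Defs.v *)
From HB Require Import structures.
From mathcomp Require Import all_boot all_order all_algebra.
From mathcomp Require Import classical_sets reals.

Set Implicit Arguments.
Unset Strict Implicit.
Unset Printing Implicit Defensive.

Import Order.TTheory GRing.Theory Num.Theory.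

Local Open Scope ring_scope.

Definition is_minimum (R : realType) (A : set R) (m : R) : Prop :=
  A m /\ lbound A m.

(** A digraph on the vertex set [V] is given by its adjacency relation [e];
    costs are functions [c v w], only meaningful when [e v w] holds.  A dipath
    starting at [v] is the sequence of its vertices after [v]. *)
Definition dipath (V : finType) (e : rel V) (v w : V) : set (seq V) :=
  fun p => [/\ path e v p, last v p = w & uniq (v :: p)].

Definition dipath_cost (R : realType) (V : finType) (c : V -> V -> R)
    (v : V) (p : seq V) : R :=
  \sum_(r <- pairmap c v p) r.

(** This forces the digraph to be strongly connected: a minimum has to be
    attained.  The diagonal values [c' v v] are left unspecified. *)
Definition is_metric_completion (R : realType) (V : finType) (e : rel V)
    (c c' : V -> V -> R) : Prop :=
  forall v w : V, v != w ->
    is_minimum (dipath_cost c v @` dipath e v w)%classic (c' v w).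

Definition arc (V : finType) : finType := {a : V * V | a.1 != a.2}.

Definition src (V : finType) (a : arc V) : V := (val a).1.
Definition tgt (V : finType) (a : arc V) : V := (val a).2.

Definition delta_out (V : finType) (U : {set V}) : {set arc V} :=
  [set a | (src a \in U) && (tgt a \notin U)].

Definition delta_in (V : finType) (U : {set V}) : {set arc V} :=
  [set a | (src a \notin U) && (tgt a \in U)].

(** A Hamiltonian dicycle of the complete digraph is the duplicate-free cyclic
    sequence of its vertices; the relation [x != y] excludes the one-vertex
    "cycle". *)
Definition hamiltonian_dicycle (V : finType) : set (seq V) :=
  fun s => ucycle [rel x y | x != y] s /\ forall v : V, v \in s.

Definition dicycle_cost (R : realType) (V : finType) (c : V -> V -> R)
    (s : seq V) : R :=
  \sum_(v <- s) c v (next s v).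

(** [(a, b)] stands for the inequality [\sum_i a i * y i >= b]. *)
Definition ineq (R : realType) (I : finType) : Type := ({ffun I -> R} * R)%type.

(** The vectors of the tightening are indexed by the sets of cardinality at
    most [t + 1]; they are extended by 0 to all sets. *)
Definition SA (R : realType) (I : finType) (t : nat) (sys : seq (ineq R I)) :
    set ({set I} -> R) :=
  fun y => [/\ y finset.set0 = 1,
     forall S : {set I}, (t.+1 < #|S|)%N -> y S = 0
   & forall (a : {ffun I -> R}) (b : R), (a, b) \in sys ->
     forall S Q : {set I}, [disjoint S & Q] -> (#|S| + #|Q| <= t)%N ->
     b * (\sum_(T : {set I} | T \subset Q) (-1) ^+ #|T| * y (S :|: T)) <=
     \sum_(i : I) a i *
       (\sum_(T : {set I} | T \subset Q)
          (-1) ^+ #|T| * y (S :|: T :|: [set i]))].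

Definition chi (R : realType) (I : finType) (F : {set I}) : {ffun I -> R} :=
  [ffun i => (i \in F)%:R].

Definition balanced_system (R : realType) (V : finType) :
    seq (ineq R (arc V)) :=
  let cuts := [seq U <- enum {set V} | (U != finset.set0) && (U != [set: V])] in
  let bal v := chi R (delta_out [set v]) - chi R (delta_in [set v]) in
  [seq (chi R (delta_in U), 1) | U <- cuts] ++
  [seq (chi R (delta_out U), 1) | U <- cuts] ++
  [seq (bal v, 0) | v <- enum V] ++
  [seq (- bal v, 0) | v <- enum V] ++
  [seq (chi R [set a], 0) | a <- enum (arc V)] ++
  [seq (- chi R [set a], - 1) | a <- enum (arc V)].

Definition SA_cost (R : realType) (V : finType) (c : V -> V -> R)
    (y : {set arc V} -> R) : R :=
  \sum_(a : arc V) c (src a) (tgt a) * y [set a].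

(** If the LP optimum is 0 the quotient is 0 by convention, so a positive lower
    bound on the ratio entails that the LP optimum is nonzero. *)
Definition is_integrality_ratio (R : realType) (V : finType) (t : nat)
    (c : V -> V -> R) (rho : R) : Prop :=
  exists opt lp : R,
    [/\ is_minimum (dicycle_cost c @` @hamiltonian_dicycle V)%classic opt,
        is_minimum (SA_cost c @` SA t (balanced_system R V))%classic lp
      & rho = opt / lp].

(* Main.v *)
(** G is the theta graph: K = 2t+3 internally disjoint bidirected paths ("rows"),
    each with M > 2/eps interior vertices, joining two common end vertices.  The
    cost of an arc is the number of its interior endpoints divided by 2, so a row
    costs M in either direction.

    LP value: a "solution" traverses every row once, forward or backward.  As K is
    odd, no such choice is balanced at the two ends, but a signed measure on the
    choices that pretends that exactly K/2 rows are forward has nonnegative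
    marginals as long as at most t+1 rows are inspected, so level t accepts it.
    Its value is K * M, and this is optimal because each of the K * M interior
    vertices needs one unit in and one unit out.

    Tours: in a closed spanning walk, let X i j be the number of traversals of the
    j-th edge of row i.  Parity of crossings of a cut shows that X i j + X i j' is
    even and positive for j <> j', and that \sum_i X i 0 is even.  As K is odd,
    some row has all its X i j even, hence at least 2 except for one of them, so the
    row costs at least 2M - 2, and every other row costs at least M. *)
From mathcomp Require Import boolp classical_sets reals.
From mathcomp Require Import all_boot all_order all_algebra.
From mathcomp Require Import zify ring lra.
Require Import Defs.

Set Implicit Arguments.
Unset Strict Implicit.
Unset Printing Implicit Defensive.

Import Order.TTheory GRing.Theory Num.Theory.
Local Open Scope ring_scope.

(** Only subsets of [Q :&: X] contribute. If that intersection contains some [z], pairing [T] with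
    [z |: T] cancels everything; otherwise only the empty set is left. *)
Lemma alternating_sum_subsets (R : pzRingType) (I : finType) (Q X : {set I}) :
  \sum_(T : {set I} | T \subset Q) (-1) ^+ #|T| * (T \subset X)%:R =
  [disjoint Q & X]%:R :> R.
Proof.
rewrite -setI_eq0; set Z := Q :&: X.
transitivity (\sum_(T in powerset Z) (-1) ^+ #|T| : R).
  rewrite big_mkcond [RHS]big_mkcond; apply: eq_bigr => T _.
  by rewrite powersetE subsetI; do 2?case: (_ \subset _); rewrite /= ?mulr1 ?mulr0.
have [->|[z zZ]] := set_0Vmem Z.
  by rewrite powerset0 big_set1 cards0 expr0 eqxx.
have /negPf -> : Z != set0 by apply/set0Pn; exists z.
rewrite (bigID (fun T : {set I} => z \in T)) /=.
rewrite (reindex_onto (fun T => z |: T) (fun T => T :\ z)) /=; last first.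
  by move=> T /andP[_ zT]; rewrite setD1K.
rewrite (eq_bigl (fun T => (T \in powerset Z) && (z \notin T))); last first.
  move=> T; rewrite !powersetE setU11 andbT subUset sub1set zZ /=.
  have [zT|zT] := boolP (z \in T); last by rewrite setU1K ?eqxx ?andbT.
  rewrite andbF; apply/negbTE; apply/negP => /andP[_ /eqP TE].
  by move: zT; rewrite -TE !inE eqxx.
rewrite -big_split big1 //= => T /andP[_ zT].
by rewrite cardsU1 zT exprS mulN1r addNr.
Qed.

(** * A signed measure behaving like a random set of half the elements *)

Lemma disjointsU1 (I : finType) (i : I) (A B : {set I}) :
  [disjoint i |: A & B] = (i \notin B) && [disjoint A & B].
Proof. by rewrite !disjoints_subset subUset sub1set in_setC. Qed.

Lemma cardsU_disjoint (I : finType) (A B : {set I}) :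
  [disjoint A & B] -> #|A :|: B| = (#|A| + #|B|)%N.
Proof. by move=> dAB; apply/eqP; rewrite (leq_card_setU A B).2. Qed.

Section PseudoMeasure.
Variables (R : realFieldType) (I : finType).
Implicit Types (A B O : {set I}) (f g : {set I} -> R).

Let n := #|I|.

(** [2 ^ p] times the falling factorial [(n/2) (n/2 - 1) ... (n/2 - p + 1)]. *)
Definition half_ff (p : nat) : R := \prod_(r < p) (n%:R - 2 * r%:R).

(** The probability that [p] given elements lie in a uniformly random set of size
    [n/2] and [q] other ones do not.  For odd [n] there is no such set, and only
    the small marginals are nonnegative. *)
Definition marginal (p q : nat) : R :=
  half_ff p * half_ff q / \prod_(r < p + q) (2 * (n%:R - r%:R)).

(** For even [n] this is the uniform distribution on the sets of size n/2; for odd [n] at least 3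
    some weights are negative. *)
Definition pmeasure O : R := marginal #|O| #|~: O|.

(** An expectation over an event, left unnormalised so that it is additive when the event is
    split. *)
Definition pexp A B f : R :=
  \sum_(O : {set I} | (A \subset O) && (B \subset ~: O)) pmeasure O * f O.

Lemma marginal_ge0 p q : ((p + q).*2 <= n)%N -> 0 <= marginal p q.
Proof.
move=> pqn; have ff_ge0 k : (k.*2 <= n)%N -> 0 <= half_ff k.
  move=> kn; apply: prodr_ge0 => r _; rewrite subr_ge0 -natrM ler_nat.
  by have := ltn_ord r; lia.
rewrite /marginal divr_ge0 ?mulr_ge0 ?ff_ge0 //; try by lia.
apply: prodr_ge0 => r _; rewrite mulr_ge0 // subr_ge0 ler_nat.
by have := ltn_ord r; lia.
Qed.

Lemma marginalS p q : (p + q < n)%N ->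
  marginal p.+1 q = marginal p q * ((n%:R - 2 * p%:R) / (2 * (n%:R - (p + q)%:R))).
Proof.
by move=> pqn; rewrite /marginal /half_ff addSn !big_ord_recr /= invfM; ring.
Qed.

Lemma marginalC p q : marginal p q = marginal q p.
Proof. by rewrite /marginal (addnC p) (mulrC (half_ff p)). Qed.

(** Relative to [marginal p q], the two terms are (n - 2p) / (2(n - p - q)) and (n - 2q) / (2(n - p
    - q)), which add up to 1. This consistency is what makes [marginal] the marginals of a signed
    measure. *)
Lemma marginal_split p q : (p + q < n)%N ->
  marginal p.+1 q + marginal p q.+1 = marginal p q.
Proof.
move=> pqn; rewrite marginalS // (marginalC _ q.+1) marginalS; last by rewrite addnC.
have : n%:R - (p + q)%:R != 0 :> R by rewrite subr_eq0 eqr_nat; lia.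
rewrite (marginalC q p) (addnC q) natrD => nz.
by field.
Qed.

Lemma marginal00 : marginal 0 0 = 1.
Proof. by rewrite /marginal /half_ff !big_ord0 mulr1 divr1. Qed.

Lemma pexp_split i A B f : pexp A B f = pexp (i |: A) B f + pexp A (i |: B) f.
Proof.
rewrite /pexp (bigID (fun O => i \in O)) /=; congr (_ + _); apply: eq_bigl => O.
  by rewrite subUset sub1set andbC andbA.
by rewrite subUset sub1set inE andbCA andbA andbC andbA.
Qed.

(** Induction on the number of elements outside [A] and [B]: splitting on such an element matches
    [marginal_split], and when none is left the event is a single set. *)
Lemma pexp_mass A B : [disjoint A & B] -> pexp A B (fun=> 1) = marginal #|A| #|B|.
Proof.
move: {2}#|_| (leqnn #|~: (A :|: B)|) => k.
elim: k A B => [|k IH] A B leAB dAB.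
  have -> : B = ~: A.
    apply/setP => x; move: leAB; rewrite leqn0 cards_eq0 => /eqP/setP/(_ x).
    move: dAB => /pred0P/(_ x); rewrite !inE /=.
    by case: (x \in A); case: (x \in B).
  rewrite /pexp (big_pred1 A) ?mulr1 // => O.
  by rewrite setCS -eqEsubset eq_sym.
have [AB0|[i]] := set_0Vmem (~: (A :|: B)).
  by apply: IH => //; rewrite AB0 cards0.
rewrite in_setC in_setU negb_or => /andP[iA iB].
have lt C D : C :|: D = i |: (A :|: B) -> (#|~: (C :|: D)| <= k)%N.
  move=> ->; rewrite -ltnS (leq_trans _ leAB) // proper_card // properC.
  by rewrite properE subsetUr subUset sub1set !inE (negPf iA) (negPf iB).
have dA : [disjoint i |: A & B] by rewrite disjointsU1 // iB.
have dB : [disjoint A & i |: B] by rewrite disjoint_sym disjointsU1 1?disjoint_sym // iA.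
have ltA := lt (i |: A) B (esym (setUA _ _ _)).
have ltB := lt A (i |: B) (setUCA _ _ _).
rewrite (pexp_split i) !IH //.
rewrite !cardsU1 iA iB !add1n marginal_split //.
rewrite -cardsU_disjoint // /n -(cardsC (A :|: B)) -ltn_subLR // subnn.
by apply/card_gt0P; exists i; rewrite in_setC in_setU negb_or iA.
Qed.

Lemma eq_pexp A B f g : f =1 g -> pexp A B f = pexp A B g.
Proof. by move=> fg; apply: eq_bigr => O _; rewrite fg. Qed.

Lemma pexpD A B f g : pexp A B (fun O => f O + g O) = pexp A B f + pexp A B g.
Proof. by rewrite /pexp -big_split; apply: eq_bigr => O _; rewrite mulrDr. Qed.

Lemma pexpZ A B a f : pexp A B (fun O => a * f O) = a * pexp A B f.
Proof. by rewrite /pexp mulr_sumr; apply: eq_bigr => O _; rewrite mulrCA. Qed.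

Lemma pexp_sum A B (J : finType) (F : J -> {set I} -> R) :
  pexp A B (fun O => \sum_j F j O) = \sum_j pexp A B (F j).
Proof. by rewrite /pexp exchange_big; apply: eq_bigr => O _; rewrite mulr_sumr. Qed.

Lemma pexp_in A B i : pexp A B (fun O => (i \in O)%:R) = pexp (i |: A) B (fun=> 1).
Proof.
rewrite /pexp (bigID (fun O => i \in O)) /= [X in _ + X]big1 ?addr0; last first.
  by move=> O /andP[_ /negPf ->]; rewrite mulr0.
by apply: eq_big => [O|O /andP[_ ->] //]; rewrite subUset sub1set andbC andbA.
Qed.

Lemma pexp_notin A B i : pexp A B (fun O => (i \notin O)%:R) = pexp A (i |: B) (fun=> 1).
Proof.
have -> : pexp A B (fun O => (i \notin O)%:R) =
    pexp A B (fun O => 1 + -1 * (i \in O)%:R).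
  by apply: eq_pexp => O; case: (i \in O) => /=; ring.
by rewrite pexpD pexpZ pexp_in (pexp_split i A B); ring.
Qed.

Lemma pexp_mass_ge0 A B : ((#|A| + #|B|).*2 <= n)%N -> 0 <= pexp A B (fun=> 1).
Proof.
move=> leAB; have [dAB|ndAB] := boolP [disjoint A & B].
  by rewrite pexp_mass // marginal_ge0.
rewrite /pexp big1 // => O /andP[AO BO]; case/negP: ndAB.
by rewrite disjoint_sym disjoints_subset (subset_trans BO) // setCS.
Qed.

(** With p = [#|A|] and q = [#|B|], the elements of [A] count p, and each of the n - p - q free ones
    has conditional weight (n - 2p) / (2(n - p - q)). The total p + (n - 2p)/2 is n/2 whatever the
    parity of [n], provided that some element is free. *)
Lemma pexp_card A B : [disjoint A & B] -> (#|A| + #|B| < n)%N ->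
  pexp A B (fun O => #|O|%:R) = n%:R / 2 * pexp A B (fun=> 1).
Proof.
move=> dAB ltAB.
have -> : pexp A B (fun O => #|O|%:R) = \sum_i pexp (i |: A) B (fun=> 1).
  under eq_bigr do rewrite -pexp_in.
  rewrite -pexp_sum; apply: eq_pexp => O.
  by rewrite -sum1_card natr_sum big_mkcond; apply: eq_bigr => i _; case: ifP.
rewrite (bigID (mem A)) /= (eq_bigr (fun=> marginal #|A| #|B|)); last first.
  by move=> i iA; rewrite (setUidPr _) ?sub1set // pexp_mass.
rewrite [X in _ + X](bigID (mem B)) /= [X in _ + (X + _)]big1; last first.
  move=> i /andP[_ iB]; rewrite /pexp big_pred0 // => O.
  apply/negbTE/negP => /andP[/subsetP/(_ i)]; rewrite setU11 => /(_ isT) iO.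
  by move=> /subsetP/(_ _ iB); rewrite inE iO.
rewrite [X in _ + (_ + X)](eq_bigr (fun=> marginal #|A|.+1 #|B|)); last first.
  move=> i /andP[iA iB]; rewrite pexp_mass ?cardsU1 ?iA ?disjointsU1 ?iB //.
rewrite !sumr_const pexp_mass // add0r.
have -> : #|(fun i => (i \notin A) && (i \notin B))| = (n - (#|A| + #|B|))%N.
  have -> : (#|A| + #|B| = #|A :|: B|)%N.
    by rewrite cardsU_disjoint.
  rewrite /n -(cardsC (A :|: B)) addKn; apply: eq_card => i.
  by rewrite in_setC in_setU negb_or.
rewrite -(mulr_natr (marginal #|A| #|B|)) -(mulr_natr (marginal #|A|.+1 #|B|)) marginalS //.
rewrite natrB 1?ltnW // natrD.
have nz : n%:R - (#|A|%:R + #|B|%:R) != 0 :> R.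
  by rewrite -natrD subr_eq0 eqr_nat; lia.
by field.
Qed.

End PseudoMeasure.

(** * Sherali-Adams vectors from signed measures *)

Section SignedMeasure.
Variables (R : realType) (I J : finType) (t : nat) (sys : seq (ineq R I)).
Variables (w : J -> R) (X : J -> {set I}).

Definition moments (S : {set I}) : R :=
  if (#|S| <= t.+1)%N then \sum_j w j * (S \subset X j)%:R else 0.

Definition restricted_mass (S Q : {set I}) (f : J -> R) : R :=
  \sum_(j | (S \subset X j) && [disjoint Q & X j]) w j * f j.

(** Exchanging the sums leaves, for each [j], an alternating sum that is the indicator of [Q] being
    disjoint from [X j]. The size bound keeps every index within the range where [moments] is not
    truncated to 0. *)
Lemma moments_inclusion_exclusion (S Q S' : {set I}) :
  (#|S| + #|Q| + #|S'| <= t.+1)%N ->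
  \sum_(T : {set I} | T \subset Q) (-1) ^+ #|T| * moments (S :|: T :|: S') =
  restricted_mass S Q (fun j => (S' \subset X j)%:R).
Proof.
move=> leSQ; rewrite /restricted_mass big_mkcond [RHS]big_mkcond /=.
transitivity (\sum_(j : J) \sum_(T : {set I} | T \subset Q)
   (-1) ^+ #|T| * (w j * (S :|: T :|: S' \subset X j)%:R)).
  rewrite -big_mkcond exchange_big /=; apply: eq_bigr => T TQ.
  rewrite /moments ifT -?mulr_sumr // (leq_trans _ leSQ) //.
  rewrite (leq_trans (leq_card_setU _ _)) // leq_add2r.
  by rewrite (leq_trans (leq_card_setU _ _)) // leq_add2l subset_leq_card.
apply: eq_bigr => j _.
transitivity (w j * (S \subset X j)%:R * (S' \subset X j)%:R *
    \sum_(T : {set I} | T \subset Q) (-1) ^+ #|T| * (T \subset X j)%:R).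
  rewrite mulr_sumr; apply: eq_bigr => T _; rewrite !subUset.
  by case: (S \subset _); case: (T \subset _); case: (S' \subset _) => /=; ring.
rewrite alternating_sum_subsets.
by case: (S \subset _); case: [disjoint _ & _] => /=; ring.
Qed.

(** The Sherali-Adams inequality for [S] and [Q] says that the slack of the original inequality has
    nonnegative signed mass on the event that [X j] contains [S] and avoids [Q]. *)
Lemma SA_moments : \sum_j w j = 1 ->
  (forall (a : {ffun I -> R}) (b : R), (a, b) \in sys ->
   forall S Q : {set I}, (#|S| + #|Q| <= t)%N ->
   0 <= restricted_mass S Q (fun j => \sum_(i in X j) a i - b)) ->
  SA t sys moments.
Proof.
move=> w1 sysP; split.
- by rewrite /moments cards0 -[RHS]w1; apply: eq_bigr => j _; rewrite sub0set mulr1.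
- by move=> S; rewrite /moments ltnNge => /negPf ->.
move=> a b ab S Q _ leSQ.
have := sysP a b ab S Q leSQ.
rewrite [restricted_mass _ _ _](_ : _ = \sum_(i : I) a i * 
    restricted_mass S Q (fun j => ([set i] \subset X j)%:R) -
    b * restricted_mass S Q (fun=> 1)); last first.
  under eq_bigr do rewrite mulr_sumr.
  rewrite exchange_big mulr_sumr -sumrB; apply: eq_bigr => j _ /=.
  rewrite mulrBr mulr1 [w j * b]mulrC; congr (_ - _).
  rewrite big_mkcond mulr_sumr; apply: eq_bigr => i _.
  by rewrite sub1set; case: (i \in X j) => /=; ring.
have -> : \sum_(T : {set I} | T \subset Q) (-1) ^+ #|T| * moments (S :|: T) =
    restricted_mass S Q (fun=> 1).
  have := @moments_inclusion_exclusion S Q set0; rewrite cards0 addn0.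
  move=> /(_ (leqW leSQ)).
  under eq_bigr do rewrite setU0.
  by move=> ->; apply: eq_bigr => j _; rewrite sub0set.
move=> ge_b.
under eq_bigr do rewrite moments_inclusion_exclusion ?cards1 ?addn1 //.
by rewrite -subr_ge0.
Qed.

End SignedMeasure.

(** * The theta graph and its fractional solution *)

Section Theta.
Variables (k m : nat).

Let vtype : finType := option (option ('I_k.+1 * 'I_m.+1)).

Definition theta_order : nat := #|vtype|.

Notation V := 'I_theta_order.
Implicit Types (i : 'I_k.+1) (u v : V) (O : {set 'I_k.+1}).

(** The [j]-th vertex of row [i]: all rows share [vtx i 0] (encoded by [None]) and
    [vtx i m.+2] (encoded by [Some None], as [insub] fails there). *)
Definition vtx i (j : nat) : V :=
  enum_rank (if j is j'.+1 then Some (omap (pair i) (insub j')) else None : vtype).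

(** The value at the two end vertices is irrelevant. *)
Definition row v : 'I_k.+1 :=
  if enum_val v : vtype is Some (Some x) then x.1 else ord0.

Definition col v : nat :=
  match enum_val v : vtype with
  | None => 0 | Some None => m.+2 | Some (Some x) => x.2.+1
  end.

Definition interior v := (0 < col v <= m.+1)%N.

Lemma theta_orderE : theta_order = (k.+1 * m.+1).+2.
Proof. by rewrite /theta_order !card_option card_prod !card_ord. Qed.

Lemma col_vtx i j : (j <= m.+2)%N -> col (vtx i j) = j.
Proof.
rewrite /col /vtx enum_rankK; case: j => //= j; rewrite ltnS => jm.
by case: insubP => [x _ /= -> //|] /=; rewrite -leqNgt => ?; lia.
Qed.

Lemma row_vtx i j : (0 < j <= m.+1)%N -> row (vtx i j) = i.
Proof.
rewrite /row /vtx enum_rankK; case: j => //= j jm.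
by case: insubP => //=; rewrite jm.
Qed.

Lemma vtx_row_col v : vtx (row v) (col v) = v.
Proof.
rewrite /vtx /row /col -[RHS]enum_valK; congr enum_rank.
case: (enum_val v) => [[[i j]|]|] //=; first by rewrite insubT //= => ?; congr (Some (Some (_, _)));
  apply: val_inj.
by rewrite insubF // ltnn.
Qed.

Lemma col_le v : (col v <= m.+2)%N.
Proof. by rewrite /col; case: (enum_val v) => [[[i j]|]|] //=; rewrite leqW. Qed.

Lemma vtx_first i i' : vtx i 0 = vtx i' 0. Proof. by []. Qed.

Lemma vtx_last i i' : vtx i m.+2 = vtx i' m.+2.
Proof. by rewrite /vtx insubF // ltnn. Qed.

Definition walk_arc i (j : nat) (b : bool) : V * V :=
  if b then (vtx i j, vtx i j.+1) else (vtx i j.+1, vtx i j).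

Lemma walk_arc_neq i (j : 'I_m.+2) b : (walk_arc i j b).1 != (walk_arc i j b).2.
Proof.
have jm := ltn_ord j.
by apply/eqP => /(congr1 col); case: b; rewrite /= !col_vtx ?(ltnW jm) //; lia.
Qed.

Lemma walk_arc_inj i i' (j j' : 'I_m.+2) b b' :
  walk_arc i j b = walk_arc i' j' b' -> [/\ i = i', j = j' & b = b'].
Proof.
have jm := ltn_ord j; have jm' := ltn_ord j' => E.
have [Ej Eb] : j = j' :> nat /\ b = b'.
  have := congr1 (fun x => (col x.1, col x.2)) E.
  by case: b b' {E} => [] []; rewrite /= !col_vtx ?(ltnW jm, ltnW jm') // => -[]; lia.
split=> //; last exact: val_inj.
have {E Eb} [E E'] : vtx i j = vtx i' j /\ vtx i j.+1 = vtx i' j.+1.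
  by move: E; rewrite -Ej -Eb; case: b Eb => _ [].
(* The row can be read off an interior vertex only. For [j = 0] the vertex [vtx i 0] is shared by
   all rows, so the other end is used. *)
have [j0|j0] := posnP j.
  by have := congr1 row E'; rewrite !row_vtx // j0.
by have := congr1 row E; rewrite !row_vtx ?j0.
Qed.

Definition theta_rel : rel V := fun u v =>
  [exists i, exists j : 'I_m.+2, exists b, (u, v) == walk_arc i j b].

Lemma theta_relP u v :
  reflect (exists i (j : 'I_m.+2) b, (u, v) = walk_arc i j b) (theta_rel u v).
Proof.
apply: (iffP existsP) => [[i /existsP[j /existsP[b /eqP E]]]|[i [j [b E]]]].
  by exists i, j, b.
by exists i; apply/existsP; exists j; apply/existsP; exists b; apply/eqP.
Qed.

Definition theta_arc i (j : 'I_m.+2) b : arc V := Sub (walk_arc i j b) (walk_arc_neq i j b).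

Lemma theta_arc_inj i i' (j j' : 'I_m.+2) b b' :
  theta_arc i j b = theta_arc i' j' b' -> [/\ i = i', j = j' & b = b'].
Proof. by move=> /(congr1 val); apply: walk_arc_inj. Qed.

Definition orient O : {set arc V} :=
  [set theta_arc x.1 x.2 (x.1 \in O) | x : 'I_k.+1 * 'I_m.+2].

Lemma mem_orient O i j b : (theta_arc i j b \in orient O) = ((i \in O) == b).
Proof.
apply/imsetP/eqP => [[[i' j'] _] /theta_arc_inj /= [-> _ ->] //|<-].
by exists (i, j).
Qed.

Lemma orientP O (a : arc V) : a \in orient O -> exists i j b, a = theta_arc i j b.
Proof. by move=> /imsetP[[i j] _ ->]; exists i, j, (i \in O). Qed.

Lemma sum_orient (R : nmodType) O (g : arc V -> R) :
  \sum_(a in orient O) g a = \sum_i \sum_(j < m.+2) g (theta_arc i j (i \in O)).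
Proof.
rewrite big_imset /=; last by move=> [i j] [i' j'] _ _ /theta_arc_inj /= [-> ->].
by rewrite pair_big /=; apply: eq_big => x; rewrite ?inE.
Qed.

End Theta.

(** * Feasibility of the signed measure on row orientations at level [t] *)

Lemma exists_rise (p : pred nat) (a b : nat) : (a < b)%N -> ~~ p a -> p b ->
  exists j, [/\ (a <= j)%N, (j < b)%N, ~~ p j & p j.+1].
Proof.
elim: b => // b IH; rewrite ltnS leq_eqVlt => /orP[/eqP <-|ltab] pa pb.
  by exists a.
have [pb'|pb'] := boolP (p b); last by exists b; rewrite ltnW.
by have [j [aj jb pj pj1]] := IH ltab pa pb'; exists j; rewrite leqW.
Qed.

Section ThetaFeasible.
Variables (R : realType) (k m t : nat).
Hypothesis tk : (t.+1.*2 <= k.+1)%N.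

Notation V := 'I_(theta_order k m).
Implicit Types (i : 'I_k.+1) (u v : V) (O A B : {set 'I_k.+1}).
Implicit Types (a : arc V) (S Q : {set arc V}) (U : {set V}).

(** Each row has at least one interior vertex, so every arc of the theta graph has an interior
    endpoint, and this endpoint determines its row. *)
Definition arc_row a := if interior (src a) then row (src a) else row (tgt a).

Lemma arc_row_theta i (j : 'I_m.+2) b : arc_row (theta_arc i j b) = i.
Proof.
have jm := ltn_ord j; rewrite /arc_row /interior /src /tgt /=.
case: b => /=; rewrite col_vtx ?(ltnW jm) //; case: ifP => Hj.
- by rewrite row_vtx.
- by rewrite row_vtx //; move: Hj; lia.
- by rewrite row_vtx.
- by rewrite row_vtx //; move: Hj; lia.
Qed.

(** Membership of an arc in [orient O] depends on at most one row. Hence an event on arcs is either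
    impossible or an event on rows that prescribes at most one row per arc. *)
Lemma restricted_mass_orient S Q :
  (forall f, restricted_mass (@pmeasure R 'I_k.+1) (@orient k m) S Q f = 0) \/
  exists A B, [/\ [disjoint A & B], (#|A| + #|B| <= #|S| + #|Q|)%N &
    forall f, restricted_mass (@pmeasure R 'I_k.+1) (@orient k m) S Q f = pexp A B f].
Proof.
have [/existsP[O0 /andP[SO0 QO0]]|] :=
    boolP [exists O, (S \subset orient m O) && [disjoint Q & orient m O]]; last first.
  rewrite negb_exists => /forallP noO; left=> f; rewrite /restricted_mass big_pred0 //.
  by move=> O; apply/negbTE.
(* Any [O0] satisfying the event [S \subset orient O], [disjoint Q] shows that
   the rows it forces forward and those it forces backward are disjoint. *)
right; pose forced b := [set i | [exists j, (theta_arc i j b \in S) || (theta_arc i j (~~ b) \in Q)]].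
have forcedP O b i : S \subset orient m O -> [disjoint Q & orient m O] ->
    i \in forced b -> (i \in O) = b.
  move=> /subsetP SO QO; rewrite inE => /existsP[j /orP[/SO|iQ]].
    by rewrite mem_orient => /eqP.
  have := disjointFr QO iQ; rewrite mem_orient.
  by case: (i \in O); case: b {iQ}.
have dAB : [disjoint forced true & forced false].
  apply/pred0P => i /=; apply/negbTE/negP => /andP[].
  by move=> /(forcedP _ _ _ SO0 QO0) iO /(forcedP _ _ _ SO0 QO0); rewrite iO.
exists (forced true), (forced false); split=> //.
  rewrite -cardsU_disjoint // (leq_trans _ (leq_card_setU S Q)) //.
  rewrite (leq_trans _ (leq_imset_card arc_row (S :|: Q))) //.
  apply/subset_leq_card/subsetP => i.
  have inSQ j b : theta_arc i j b \in S :|: Q -> i \in arc_row @: (S :|: Q).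
    by move=> /(imset_f arc_row); rewrite arc_row_theta.
  rewrite !inE => /orP[] /existsP[j /orP[] ij];
    first [by apply: (inSQ j true); rewrite inE ij ?orbT
          |by apply: (inSQ j false); rewrite inE ij ?orbT].
move=> f; apply: eq_bigl => O; apply/andP/andP => [[SO QO]|[AO BO]].
  split; apply/subsetP => i /(forcedP O _ _ SO QO); rewrite ?inE => -> //.
split.
  apply/subsetP => a aS; have [i [j [b ab]]] := orientP (subsetP SO0 _ aS).
  have : i \in forced b by rewrite inE; apply/existsP; exists j; rewrite -ab aS.
  rewrite ab mem_orient; case: b {ab} => [/(subsetP AO) ->//|/(subsetP BO)].
  by rewrite inE => /negbTE ->.
rewrite disjoint_subset; apply/subsetP => a aQ; rewrite inE; apply/negP => aO.
have [i [j [b ab]]] := orientP aO; move: aO; rewrite ab mem_orient.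
have : i \in forced (~~ b).
  by rewrite inE; apply/existsP; exists j; rewrite negbK -ab aQ orbT.
case: b {ab} => [/(subsetP BO)|/(subsetP AO) ->//].
by rewrite inE => /negbTE ->.
Qed.

Section LocalConstraints.
Variables A B : {set 'I_k.+1}.
Hypotheses (dAB : [disjoint A & B]) (leAB : (#|A| + #|B| <= t)%N).

Let ltAB : (#|A| + #|B| < #|'I_k.+1|)%N.
Proof. by rewrite card_ord; move: leAB tk; lia. Qed.

Local Notation E := (@pexp R 'I_k.+1 A B).

(** Row [i] together with [A] and [B] makes at most [t.+1] prescribed rows, at most half of all
    rows, which is the range where marginals are nonnegative. *)
Lemma pexp_literal_ge0 i b : 0 <= E (fun O => ((i \in O) == b)%:R).
Proof.
have card1 C : (#|i |: C| <= #|C|.+1)%N.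
  by rewrite cardsU1; case: (_ \notin _).
have leAB1 : ((#|A| + #|B|).+1 <= t.+1)%N by [].
rewrite (eq_pexp _ _ (g := fun O => if b then (i \in O)%:R else (i \notin O)%:R)).
  case: b; rewrite /= ?pexp_in ?pexp_notin pexp_mass_ge0 // card_ord (leq_trans _ tk) //;
    rewrite leq_double (leq_trans _ leAB1) //.
    by rewrite -addSn leq_add2r.
  by rewrite -addnS leq_add2l.
by move=> O; case: b; case: (i \in O).
Qed.

Lemma pexp_literal_add i :
  E (fun O => ((i \in O) == true)%:R) + E (fun O => ((i \in O) == false)%:R) =
  E (fun=> 1).
Proof. by rewrite -pexpD; apply: eq_pexp => O; case: (i \in O) => /=; ring. Qed.

Lemma sum_pexp_literal b :
  \sum_i E (fun O => ((i \in O) == b)%:R) = k.+1%:R / 2 * E (fun=> 1).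
Proof.
have in_sum : \sum_i E (fun O => ((i \in O) == true)%:R) = k.+1%:R / 2 * E (fun=> 1).
  have := pexp_card R dAB ltAB; rewrite card_ord => <-.
  rewrite -pexp_sum; apply: eq_pexp => O.
  by rewrite -sum1_card natr_sum [RHS]big_mkcond; apply: eq_bigr => i _; case: (i \in O).
case: b => //.
have : \sum_i (E (fun O => ((i \in O) == true)%:R) + E (fun O => ((i \in O) == false)%:R)) =
    k.+1%:R * E (fun=> 1).
  under eq_bigr do rewrite pexp_literal_add.
  by rewrite sumr_const card_ord mulr_natl.
by rewrite big_split /= in_sum => H; lra.
Qed.

Lemma pexp_sum_orient (g : arc V -> R) (b : R) :
  E (fun O => \sum_(a in orient m O) g a - b) =
  \sum_i \sum_(o : bool) E (fun O => ((i \in O) == o)%:R) * (\sum_j g (theta_arc i j o))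
    - b * E (fun=> 1).
Proof.
rewrite (eq_pexp _ _ (g := fun O => \sum_i \sum_(o : bool)
    (\sum_j g (theta_arc i j o)) * ((i \in O) == o)%:R + (- b) * 1)); last first.
  move=> O; rewrite sum_orient mulr1; congr (_ - _); apply: eq_bigr => i _.
  by rewrite big_bool; case: (i \in O) => /=; ring.
rewrite pexpD (pexpZ A B (- b)) mulNr; congr (_ - _).
rewrite pexp_sum; apply: eq_bigr => i _.
by rewrite pexp_sum; apply: eq_bigr => o _; rewrite pexpZ mulrC.
Qed.

(** Along a forward row the terms telescope to a difference [s * d] between the two end vertices,
    along a backward row to its opposite. By [sum_pexp_literal] both directions have the same total
    weight. The sign [s] covers both halves of the equation. *)
Lemma pexp_balance v (s : R) :
  E (fun O => \sum_(a in orient m O) s * ((src a == v)%:R - (tgt a == v)%:R) - 0) = 0.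
Proof.
rewrite pexp_sum_orient mul0r subr0 exchange_big big_bool /=.
have tele (g : nat -> R) : \sum_(j < m.+2) (g j - g j.+1) = g 0%N - g m.+2.
  rewrite -(big_mkord xpredT (fun j => g j - g j.+1)) -opprB -telescope_sumr // -sumrN.
  by apply: eq_bigr => j _; rewrite opprB.
pose d : R := (vtx m (ord0 : 'I_k.+1) 0 == v)%:R - (vtx m (ord0 : 'I_k.+1) m.+2 == v)%:R.
rewrite (eq_bigr (fun i => E (fun O => ((i \in O) == true)%:R) * (s * d))); last first.
  move=> i _; congr (_ * _); rewrite -mulr_sumr /src /tgt /=; congr (_ * _).
  by rewrite (tele (fun j => (vtx m i j == v)%:R)) (vtx_last _ i ord0).
rewrite [X in _ + X](eq_bigr (fun i => E (fun O => ((i \in O) == false)%:R) * - (s * d))); last first.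
  move=> i _; congr (_ * _); rewrite -mulr_sumr /src /tgt /= -mulrN; congr (_ * _).
  rewrite /d -(vtx_first _ i ord0) -(vtx_last _ i ord0) -(tele (fun j => (vtx m i j == v)%:R)).
  by rewrite -sumrN; apply: eq_bigr => j _; rewrite opprB.
by rewrite -!mulr_suml !sum_pexp_literal; ring.
Qed.

Lemma forward_enters U i (j1 j2 : nat) : (j1 < j2 <= m.+2)%N ->
  vtx m i j1 \notin U -> vtx m i j2 \in U ->
  exists j : 'I_m.+2, theta_arc i j true \in delta_in U.
Proof.
move=> /andP[j12 j2m] j1U j2U.
have [j [_ jj2 jU jU']] := exists_rise (p := fun j => vtx m i j \in U) j12 j1U j2U.
by exists (Ordinal (leq_trans jj2 j2m)); rewrite inE /src /tgt /= jU.
Qed.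

Lemma backward_enters U i (j1 j2 : nat) : (j1 < j2 <= m.+2)%N ->
  vtx m i j1 \in U -> vtx m i j2 \notin U ->
  exists j : 'I_m.+2, theta_arc i j false \in delta_in U.
Proof.
move=> /andP[j12 j2m]; rewrite -[_ \in U]negbK => j1U j2U.
have [j [_ jj2 jU jU']] := exists_rise (p := fun j => vtx m i j \notin U) j12 j1U j2U.
by exists (Ordinal (leq_trans jj2 j2m)); rewrite inE /src /tgt /= jU' -[_ \in U]negbK.
Qed.

(** If [U] separates the two ends, all rows enter it in one common direction, and their total weight
    is half the number of rows, at least 1, times the mass. Otherwise some vertex lies on the other
    side from both ends, and its row enters [U] in either direction, so the two weights of that row
    add up to the mass. *)
Lemma pexp_cut U : U != set0 -> U != [set: V] ->
  0 <= E (fun O => \sum_(a in orient m O) (a \in delta_in U)%:R - 1).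
Proof.
move=> U0 UT; rewrite pexp_sum_orient mul1r subr_ge0.
have E1 : 0 <= E (fun=> 1).
  by rewrite pexp_mass_ge0 // card_ord; move: leAB tk; lia.
have cnt_ge0 i b : 0 <= \sum_(j < m.+2) (theta_arc i j b \in delta_in U)%:R :> R.
  by apply: sumr_ge0 => j _; rewrite ler0n.
have cnt_ge1 i b : (exists j : 'I_m.+2, theta_arc i j b \in delta_in U) ->
    1 <= \sum_(j < m.+2) (theta_arc i j b \in delta_in U)%:R :> R.
  move=> [j jU]; rewrite (bigD1 j) //= jU lerDl.
  by apply: sumr_ge0 => ? _; rewrite ler0n.
have all_rows b : (forall i, exists j : 'I_m.+2, theta_arc i j b \in delta_in U) ->
    E (fun=> 1) <= \sum_i \sum_(o : bool) E (fun O => ((i \in O) == o)%:R) *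
      (\sum_(j < m.+2) (theta_arc i j o \in delta_in U)%:R).
  move=> rowsU; apply: (@le_trans _ _ (\sum_i E (fun O => ((i \in O) == b)%:R))).
    rewrite sum_pexp_literal ler_peMl // ler_pdivlMr // mul1r ler_nat.
    by move: tk; lia.
  apply: ler_sum => i _; rewrite (bigD1 b) //= -[leLHS]addr0 lerD //.
    by rewrite ler_peMr ?pexp_literal_ge0 ?cnt_ge1.
  by apply: sumr_ge0 => o _; rewrite mulr_ge0 ?pexp_literal_ge0.
have one_row i : (forall b, exists j : 'I_m.+2, theta_arc i j b \in delta_in U) ->
    E (fun=> 1) <= \sum_i \sum_(o : bool) E (fun O => ((i \in O) == o)%:R) *
      (\sum_(j < m.+2) (theta_arc i j o \in delta_in U)%:R).
  move=> rowU; rewrite (bigD1 i) //= -[leLHS]addr0 lerD //.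
    rewrite big_bool -(pexp_literal_add i) lerD // ler_peMr ?pexp_literal_ge0 //;
    exact/cnt_ge1.
  apply: sumr_ge0 => i' _; apply: sumr_ge0 => o _.
  by rewrite mulr_ge0 ?pexp_literal_ge0.
pose v0 := vtx m (ord0 : 'I_k.+1) 0; pose v1 := vtx m (ord0 : 'I_k.+1) m.+2.
have v1E i : vtx m i m.+2 = v1 by exact: vtx_last.
have [v0U|v0U] := boolP (v0 \in U); have [v1U|v1U] := boolP (v1 \in U).
- have [v vU] : exists v, v \notin U.
    by apply/existsP; rewrite -negb_forall; apply: contra UT => /forallP UV;
       apply/eqP/setP => v; rewrite UV inE.
  have vE := vtx_row_col v; move: (col_le v).
  case: (posnP (col v)) => [c0|c0].
    by move: vE v0U vU; rewrite c0 => <-; rewrite (vtx_first _ _ ord0) => ->.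
  rewrite leq_eqVlt => /orP[/eqP c1|c1].
    by move: v1U vU; rewrite -vE c1 v1E => ->.
  apply: (one_row (row v)); case.
    by apply: (@forward_enters _ _ (col v) m.+2); rewrite ?c1 ?leqnn ?vE ?v1E.
  by apply: (@backward_enters _ _ 0 (col v)); rewrite ?c0 ?vE ?(ltnW c1).
- by apply: (all_rows false) => i; apply: (@backward_enters _ _ 0 m.+2); rewrite ?leqnn ?v1E.
- by apply: (all_rows true) => i; apply: (@forward_enters _ _ 0 m.+2); rewrite ?leqnn ?v1E.
- have /set0Pn[v vU] := U0.
  have vE := vtx_row_col v; move: (col_le v).
  case: (posnP (col v)) => [c0|c0].
    by move: vE v0U vU; rewrite c0 => <-; rewrite (vtx_first _ _ ord0) => /negPf ->.
  rewrite leq_eqVlt => /orP[/eqP c1|c1].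
    by move: v1U vU; rewrite -vE c1 v1E => /negPf ->.
  apply: (one_row (row v)); case.
    by apply: (@forward_enters _ _ 0 (col v)); rewrite ?c0 ?vE ?(ltnW c1).
  by apply: (@backward_enters _ _ (col v) m.+2); rewrite ?c1 ?leqnn ?vE ?v1E.
Qed.

Lemma pexp_mem_ge0 a : 0 <= E (fun O => (a \in orient m O)%:R).
Proof.
have [/existsP[i /existsP[j /existsP[b /eqP ->]]]|] :=
    boolP [exists i, exists j : 'I_m.+2, exists b, a == theta_arc i j b].
  by rewrite (eq_pexp _ _ (g := fun O => ((i \in O) == b)%:R)) ?pexp_literal_ge0 // => O;
     rewrite mem_orient.
move=> na; rewrite /pexp big1 // => O _.
rewrite (negbTE (_ : a \notin _)) ?mulr0 //; apply: contra na => /orientP[i [j [b ->]]].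
by apply/existsP; exists i; apply/existsP; exists j; apply/existsP; exists b.
Qed.

Lemma pexp_mem_le1 a : 0 <= E (fun O => 1 - (a \in orient m O)%:R).
Proof.
have [/existsP[i /existsP[j /existsP[b /eqP ->]]]|] :=
    boolP [exists i, exists j : 'I_m.+2, exists b, a == theta_arc i j b].
  rewrite (eq_pexp _ _ (g := fun O => ((i \in O) == ~~ b)%:R)) ?pexp_literal_ge0 // => O.
  by rewrite mem_orient; case: (i \in O); case: b; rewrite /= ?subrr ?subr0.
move=> na; rewrite (eq_pexp _ _ (g := fun=> 1)) => [|O].
  by rewrite pexp_mass_ge0 // card_ord; move: leAB tk; lia.
rewrite (negbTE (_ : a \notin _)) ?subr0 //; apply: contra na => /orientP[i [j [b ->]]].
by apply/existsP; exists i; apply/existsP; exists j; apply/existsP; exists b.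
Qed.

End LocalConstraints.

Definition theta_solution : {set arc V} -> R := moments t (@pmeasure R 'I_k.+1) (@orient k m).

Lemma sum_pmeasure : \sum_O @pmeasure R 'I_k.+1 O = 1.
Proof.
transitivity (@pexp R 'I_k.+1 set0 set0 (fun=> 1)).
  by apply: eq_big => O; rewrite ?sub0set ?mulr1.
by rewrite pexp_mass ?cards0 ?marginal00 // -setI_eq0 setI0.
Qed.

Lemma theta_solution_SA : SA t (balanced_system R V) theta_solution.
Proof.
apply: SA_moments => [|f b fb S Q leSQ]; first exact: sum_pmeasure.
have [->//|[A [B [dAB leAB ->]]]] := restricted_mass_orient S Q.
have {leAB leSQ} leAB := leq_trans leAB leSQ.
have mem1 a O : \sum_(x in orient m O) chi R [set a] x = (a \in orient m O)%:R.
  rewrite (eq_bigr (fun x => (x == a)%:R)); last by move=> x _; rewrite ffunE inE.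
  have [aO|aO] := boolP (a \in _).
    by rewrite (bigD1 a) //= eqxx big1 ?addr0 // => x /andP[_ /negPf ->].
  by rewrite big1 // => x xO; case: eqP => // xa; rewrite -xa xO in aO.
have balE v a : (chi R (delta_out [set v]) - chi R (delta_in [set v])) a =
    (src a == v)%:R - (tgt a == v)%:R.
  rewrite !ffunE !inE; have := valP a; rewrite -/(src a) -/(tgt a).
  case: (src a =P v) => [->|_] /=; first by rewrite eq_sym => /negbTE ->; rewrite subr0.
  by rewrite sub0r.
move: fb; rewrite !mem_cat => /or4P[| | |/or3P[| |]] /mapP[x].
- rewrite mem_filter => /andP[/andP[x0 xT] _] [-> ->].
  rewrite (eq_pexp _ _ (g := fun O => \sum_(a in orient m O) (a \in delta_in x)%:R - 1)).
    exact: pexp_cut.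
  by move=> O; congr (_ - _); apply: eq_bigr => a _; rewrite ffunE.
- rewrite mem_filter => /andP[/andP[x0 xT] _] [-> ->].
  (* The arcs leaving [x] are those entering its complement, so the in-cut bound applies again. *)
  rewrite (eq_pexp _ _ (g := fun O => \sum_(a in orient m O) (a \in delta_in (~: x))%:R - 1)).
    apply: pexp_cut => //.
      by apply: contra xT => /eqP H; rewrite -[x]setCK H setC0.
    by apply: contra x0 => /eqP H; rewrite -[x]setCK H setCT.
  by move=> O; congr (_ - _); apply: eq_bigr => a _; rewrite ffunE !inE negbK.
- move=> _ [-> ->]; rewrite le_eqVlt; apply/orP; left; apply/eqP.
  rewrite -[LHS](pexp_balance dAB leAB x 1); apply: eq_pexp => O; congr (_ - _).
  by apply: eq_bigr => a _; rewrite balE mul1r.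
- move=> _ [-> ->]; rewrite le_eqVlt; apply/orP; left; apply/eqP.
  rewrite -[LHS](pexp_balance dAB leAB x (- 1)); apply: eq_pexp => O; congr (_ - _).
  by apply: eq_bigr => a _; rewrite mulN1r -balE !ffunE. 
- move=> _ [-> ->]; rewrite (eq_pexp _ _ (g := fun O => (x \in orient m O)%:R)).
    exact: pexp_mem_ge0.
  by move=> O; rewrite mem1 subr0.
- move=> _ [-> ->]; rewrite (eq_pexp _ _ (g := fun O => 1 - (x \in orient m O)%:R)).
    exact: pexp_mem_le1.
  move=> O; rewrite -mem1 -sumrN opprK addrC; congr (_ + _).
  by apply: eq_bigr => a _; rewrite ffunE.
Qed.

End ThetaFeasible.

(** * The optimum of the relaxation *)

(** Well-ordering of the numerators. Costs in this graph are half-integral, so this yields both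
    cheapest dipaths and a cheapest tour. *)
Lemma half_integral_minimum (R : realType) (A : set R) :
  (exists x, A x) -> (forall x, A x -> exists n : nat, x = n%:R / 2) ->
  exists x, is_minimum A x.
Proof.
move=> [x Ax] halfA.
have exA : exists n : nat, `[< A (n%:R / 2) >].
  by have [n xE] := halfA _ Ax; exists n; apply/asboolP; rewrite -xE.
case: (ex_minnP exA) => n /asboolP An minA; exists (n%:R / 2); split=> // y Ay.
have [p yE] := halfA _ Ay; rewrite yE ler_pM2r ?invr_gt0 // ler_nat.
by apply: minA; apply/asboolP; rewrite -yE.
Qed.

(** The case of empty [S] and [Q]: singleton entries satisfy the original linear system. *)
Lemma SA_base (R : realType) (I : finType) (t : nat) (sys : seq (ineq R I)) y a b :
  SA t sys y -> (a, b) \in sys -> b <= \sum_i a i * y [set i].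
Proof.
move=> [y0 _ yP] /yP /(_ set0 set0); rewrite cards0 -setI_eq0 set0I eqxx.
move=> /(_ isT isT); rewrite (big_pred1 set0) => [|T]; last by rewrite subset0.
rewrite cards0 expr0 mul1r setU0 y0 mulr1 => /le_trans; apply.
rewrite le_eqVlt; apply/orP; left; apply/eqP; apply: eq_bigr => i _.
rewrite (big_pred1 set0) => [|T]; last by rewrite subset0.
by rewrite cards0 expr0 mul1r setU0 set0U.
Qed.

Section ThetaOptimum.
Variables (R : realType) (k m : nat).

Notation V := 'I_(theta_order k m).
Implicit Types (i : 'I_k.+1) (u v w : V).

Definition theta_cost u v : R := (interior u + interior v)%:R / 2.

Lemma interior_vtx i j : (j <= m.+2)%N -> interior (vtx m i j) = (0 < j <= m.+1)%N.
Proof. by move=> jm; rewrite /interior col_vtx. Qed.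

Lemma card_interior : (\sum_v interior (v : V) = k.+1 * m.+1)%N.
Proof.
have -> : (\sum_v interior (v : V) = #|[set v : V | interior v]|)%N.
  by rewrite -sum1_card [RHS]big_mkcond; apply: eq_bigr => v _; rewrite inE; case: interior.
pose f (x : 'I_k.+1 * 'I_m.+1) : V := vtx m x.1 x.2.+1.
have f_inj : injective f.
  move=> [i j] [i' j'] ff; have jm := ltn_ord j; have jm' := ltn_ord j'.
  have := congr1 (@row k m) ff; rewrite !row_vtx //= => ->.
  by have := congr1 (@col k m) ff; rewrite !col_vtx ?(leqW jm) ?(leqW jm') // => -[/val_inj ->].
transitivity #|f @: [set: 'I_k.+1 * 'I_m.+1]|; last first.
  by rewrite card_imset // cardsT card_prod !card_ord.
apply: eq_card => v; rewrite inE; apply/idP/imsetP => [v_int|[[i j] _ ->]]; last first.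
  by rewrite interior_vtx /= ?ltn_ord // leqW.
have /andP[c0 cm] := v_int.
have c1 : ((col v).-1 < m.+1)%N by rewrite -ltnS prednK.
by exists (row v, Ordinal c1); rewrite // /f /= prednK // vtx_row_col.
Qed.

Lemma theta_rel_sym : symmetric (@theta_rel k m).
Proof.
move=> u v; apply/theta_relP/theta_relP => -[i [j [b E]]]; exists i, j, (~~ b);
  by move: E; rewrite /walk_arc; case: b => -[-> ->].
Qed.

Lemma theta_rel_irr : irreflexive (@theta_rel k m).
Proof.
move=> v; apply/theta_relP => -[i [j [b E]]].
by have := walk_arc_neq i j b; rewrite -E eqxx.
Qed.

Lemma theta_connected u v : connect (@theta_rel k m) u v.
Proof.
have from0 w : connect (@theta_rel k m) (vtx m ord0 0) w.
  rewrite -(vtx_row_col w) (vtx_first _ ord0 (row w)).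
  move: (col w) (col_le w); elim=> [|j IH] jm; first exact: connect0.
  apply: connect_trans (IH (ltnW jm)) (connect1 _).
  by apply/theta_relP; exists (row w), (Ordinal jm), true.
apply: connect_trans (from0 v); rewrite (sym_connect_sym theta_rel_sym).
exact: from0.
Qed.

Lemma theta_cost_half v p : exists n : nat, dipath_cost theta_cost v p = n%:R / 2.
Proof.
rewrite /dipath_cost; elim: p v => [|w p IH] v /=; first by exists 0; rewrite big_nil mul0r.
by have [n nE] := IH w; exists (interior v + interior w + n)%N;
   rewrite big_cons nE [in RHS]natrD mulrDl.
Qed.

Lemma theta_completion_exists : exists c', is_metric_completion (@theta_rel k m) theta_cost c'.
Proof.
have [|f fP] := @choice (V * V)%type R (fun x d => x.1 != x.2 ->
    is_minimum (dipath_cost theta_cost x.1 @` dipath (@theta_rel k m) x.1 x.2)%classic d).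
  move=> [v w] /=; have [_|vw] := eqVneq v w; first by exists 0.
  have [||d dP] := @half_integral_minimum R
    (dipath_cost theta_cost v @` dipath (@theta_rel k m) v w)%classic; last by exists d.
    have /connectP[p /shortenP[p' pp' up' _] ->] := theta_connected v w.
    by exists (dipath_cost theta_cost v p'), p'.
  by move=> _ [p _ <-]; apply: theta_cost_half.
by exists (fun v w => f (v, w)) => v w vw; apply: (fP (v, w)).
Qed.

(** The cost charges 1/2 for each interior endpoint of an arc. The first and last arcs already pay
    for [v] and [w], and intermediate vertices only add to this. *)
Lemma dipath_cost_ge v w p : v != w -> last v p = w -> theta_cost v w <= dipath_cost theta_cost v p.
Proof.
move=> vw pw; case: p pw => [/= E|x p]; first by rewrite E eqxx in vw.
elim: p v x {vw} => [|y p IH] v x /= pw.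
  by rewrite /dipath_cost /= big_seq1 pw.
have := IH x y pw; rewrite /dipath_cost /= !big_cons => le_c.
rewrite (le_trans _ (lerD (lexx (theta_cost v x)) le_c)) // /theta_cost -mulrDl.
by rewrite ler_pM2r ?invr_gt0 // -natrD ler_nat; lia.
Qed.

Variable c' : V -> V -> R.
Hypothesis c'P : is_metric_completion (@theta_rel k m) theta_cost c'.

Lemma completion_ge v w : v != w -> theta_cost v w <= c' v w.
Proof.
by move=> vw; have [[p [_ pw _] <-] _] := c'P vw; apply: dipath_cost_ge.
Qed.

Lemma completion_edge v w : theta_rel v w -> c' v w = theta_cost v w.
Proof.
move=> vw; have vw' : v != w by apply: contraTneq vw => ->; rewrite theta_rel_irr.
apply/eqP; rewrite eq_le completion_ge // andbT.
have [_ lb] := c'P vw'; apply: lb; exists [:: w].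
  by split; rewrite //= ?vw ?inE ?vw'.
by rewrite /dipath_cost /= big_seq1.
Qed.

Lemma orient_cost (O : {set 'I_k.+1}) :
  \sum_(a in orient m O) c' (src a) (tgt a) = (k.+1 * m.+1)%:R.
Proof.
rewrite (eq_bigr (fun a => theta_cost (src a) (tgt a))); last first.
  move=> a /orientP[i [j [b ->]]]; apply: completion_edge.
  by apply/theta_relP; exists i, j, b; rewrite /src /tgt /=; case: b.
rewrite sum_orient (eq_bigr (fun=> m.+1%:R)) => [|i _].
  by rewrite sumr_const card_ord natrM mulr_natl.
(* The [j]-th edge joins columns [j] and [j.+1]; the former is interior iff [0 < j], the latter iff
   [j < m.+1]. Each condition holds for [m.+1] edges of the row. *)
rewrite (eq_bigr (fun j : 'I_m.+2 => (0 < j)%N%:R / 2 + (j < m.+1)%N%:R / 2)); last first.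
  move=> j _; have jm := ltn_ord j; rewrite /theta_cost /src /tgt /= natrD mulrDl.
  case: (_ \in _); rewrite /= !interior_vtx ?(ltnW jm) //=;
    by rewrite (_ : j <= m.+1)%N ?andbT // addrC.
rewrite big_split /= -!mulr_suml big_ord_recl [X in _ + X / 2]big_ord_recr /= ltnn add0r addr0.
rewrite [X in X / 2 + _](eq_bigr (fun=> 1)) //.
rewrite [X in _ + X / 2](eq_bigr (fun=> 1)) => [|j _]; last by rewrite ltn_ord.
by rewrite sumr_const card_ord -splitr.
Qed.

(** Attained because every [orient O] has this same cost and the weights of [pmeasure] sum to 1.
    Optimality uses only nonnegativity and the cuts around single vertices. *)
Lemma theta_SA_minimum t : (t.+1.*2 <= k.+1)%N ->
  is_minimum (SA_cost c' @` SA t (balanced_system R V))%classic (k.+1 * m.+1)%:R.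
Proof.
move=> tk; split.
  exists (@theta_solution R k m t); first exact: theta_solution_SA.
  rewrite /SA_cost /theta_solution.
  under eq_bigr => a _ do rewrite /moments cards1 /= mulr_sumr.
  transitivity (\sum_O (k.+1 * m.+1)%:R * @pmeasure R 'I_k.+1 O); last first.
    by rewrite -mulr_sumr sum_pmeasure mulr1.
  rewrite exchange_big; apply: eq_bigr => O _; rewrite -(orient_cost O) mulrC mulr_sumr [RHS]big_mkcond.
  by apply: eq_bigr => a _; rewrite sub1set; case: (a \in _); rewrite ?mulr1 ?mulr0 // mulrC.
move=> _ [y ySA <-].
have y_ge0 a : 0 <= y [set a].
  have : (chi R [set a], 0) \in balanced_system R V.
    by rewrite !mem_cat (map_f (fun a => (chi R [set a], 0))) ?mem_enum ?orbT.
  move=> /(SA_base ySA); rewrite (bigD1 a) //= big1 ?addr0.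
    by rewrite ffunE inE eqxx mul1r.
  by move=> a' /negPf aa'; rewrite ffunE inE aa' mul0r.
have cut v : [set v] \in [seq U <- enum {set V} | (U != set0) && (U != [set: V])].
  rewrite mem_filter mem_enum andbT; apply/andP; split.
    by apply/set0Pn; exists v; rewrite inE.
  apply/eqP => /(congr1 (fun U : {set V} => #|U|)).
  by rewrite cards1 cardsT card_ord theta_orderE.
have y_in v : 1 <= \sum_a (tgt a == v)%:R * y [set a].
  have : (chi R (delta_in [set v]), 1) \in balanced_system R V.
    by rewrite !mem_cat (map_f (fun U => (chi R (delta_in U), 1))).
  move=> /(SA_base ySA) /le_trans; apply; apply: ler_sum => a _.
  by rewrite ler_wpM2r // ffunE !inE ler_nat; case: (tgt a == v); rewrite ?andbF //= leq_b1.
have y_out v : 1 <= \sum_a (src a == v)%:R * y [set a].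
  have : (chi R (delta_out [set v]), 1) \in balanced_system R V.
    by rewrite !mem_cat (map_f (fun U => (chi R (delta_out U), 1))) ?orbT.
  move=> /(SA_base ySA) /le_trans; apply; apply: ler_sum => a _.
  by rewrite ler_wpM2r // ffunE !inE ler_nat; case: (src a == v); rewrite //= leq_b1.
(* With [theta_cost] in place of the larger [c'], the objective regroups into half of the inflow
   plus outflow at each interior vertex, where both are at least 1. *)
apply: (@le_trans _ _ (\sum_a theta_cost (src a) (tgt a) * y [set a])); last first.
  by apply: ler_sum => a _; rewrite ler_wpM2r // completion_ge // (valP a).
rewrite -card_interior natr_sum.
have -> : \sum_(a : arc V) theta_cost (src a) (tgt a) * y [set a] =
    \sum_v (interior v)%:R / 2 * (\sum_a (src a == v)%:R * y [set a] +
                                 \sum_a (tgt a == v)%:R * y [set a]).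
  under [RHS]eq_bigr do rewrite -big_split mulr_sumr.
  rewrite exchange_big; apply: eq_bigr => a _ /=.
  have pick u : \sum_v (interior v)%:R / 2 * ((u == v)%:R * y [set a]) =
      (interior u)%:R / 2 * y [set a].
    rewrite (bigD1 u) //= eqxx mul1r big1 ?addr0 // => v /negPf.
    by rewrite eq_sym => ->; rewrite mul0r mulr0.
  under eq_bigr do rewrite mulrDr.
  by rewrite big_split /= !pick /theta_cost natrD; ring.
apply: ler_sum => v _; rewrite -mulrA ler_peMr // mulrC ler_pdivlMr // mul1r.
by rewrite -[2]/(1 + 1) lerD.
Qed.

Lemma hamiltonian_minimum_exists :
  exists opt, is_minimum (dicycle_cost c' @` @hamiltonian_dicycle V)%classic opt.
Proof.
apply: half_integral_minimum.
  exists (dicycle_cost c' (enum V)), (enum V) => //.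
  split=> [|v]; last by rewrite mem_enum.
  (* Any ordering of the vertices is a tour; having at least two of them makes the closing arc join
     distinct vertices. *)
  rewrite /ucycle enum_uniq andbT; have := enum_uniq V; have : size (enum V) = (k.+1 * m.+1).+2.
    by rewrite -cardE card_ord theta_orderE.
  case: (enum V) => [|x [|y s]] //= _ uniqs.
  rewrite rcons_path; apply/and3P; split.
  - by move: uniqs; rewrite !inE negb_or => /andP[/andP[]].
  - have : uniq (y :: s) by case/andP: uniqs.
    by rewrite uniq_pairwise => /pairwise_sorted.
  - move: uniqs => /andP[xys _]; apply: contraNneq xys => /= <-; exact: mem_last.
move=> _ [s [/andP[s_cycle _] _] <-]; rewrite /dicycle_cost big_seq.
elim/big_ind: _ => [|_ _ [n1 ->] [n2 ->]|v vs]; first by exists 0; rewrite mul0r.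
  by exists (n1 + n2)%N; rewrite natrD mulrDl.
have /c'P[[p _ <-] _] := next_cycle s_cycle vs.
exact: theta_cost_half.
Qed.

End ThetaOptimum.

(** * The cost of a tour *)

Section WalkSum.
Variable V : eqType.
Implicit Types (e : rel V) (g : V -> V -> nat) (f : pred V) (v : V) (p : seq V).

Definition walk_sum g v p : nat := (\sum_(r <- pairmap g v p) r)%N.

Definition crossings f v p : nat := walk_sum (fun x y => f x != f y) v p.

Lemma walk_sum_cons g v x p : walk_sum g v (x :: p) = (g v x + walk_sum g x p)%N.
Proof. by rewrite /walk_sum /= big_cons. Qed.

Lemma eq_walk_sum e g1 g2 v p : path e v p ->
  (forall x y, e x y -> g1 x y = g2 x y) -> walk_sum g1 v p = walk_sum g2 v p.
Proof.
move=> + eg; elim: p v => [|x p IH] v; first by rewrite /walk_sum !big_nil.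
by rewrite !walk_sum_cons => /= /andP[/eg -> /IH ->].
Qed.

Lemma walk_sumD g1 g2 v p :
  walk_sum (fun x y => g1 x y + g2 x y)%N v p = (walk_sum g1 v p + walk_sum g2 v p)%N.
Proof.
elim: p v => [|x p IH] v; first by rewrite /walk_sum !big_nil.
by rewrite !walk_sum_cons IH addnACA.
Qed.

Lemma walk_sum_sum (I : finType) (g : I -> V -> V -> nat) v p :
  walk_sum (fun x y => \sum_i g i x y)%N v p = (\sum_i walk_sum (g i) v p)%N.
Proof.
elim: p v => [|x p IH] v.
  by rewrite /walk_sum /= big_nil big1 // => i _; rewrite big_nil.
by rewrite walk_sum_cons IH -big_split; apply: eq_bigr => i _; rewrite walk_sum_cons.
Qed.

(** Each crossing flips [f]. In particular a closed walk crosses any cut an even number of times. *)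
Lemma odd_crossings f v p : odd (crossings f v p) = (f v != f (last v p)).
Proof.
rewrite /crossings; elim: p v => [|x p IH] v; first by rewrite /walk_sum big_nil eqxx.
by rewrite walk_sum_cons oddD IH /=; case: (f v); case: (f x); case: (f _).
Qed.

(** Along a walk without crossings [f] is constant. *)
Lemma crossings_gt0 f v p x y : x \in v :: p -> y \in v :: p -> f x != f y ->
  (0 < crossings f v p)%N.
Proof.
rewrite lt0n => xp yp; apply: contra => /eqP cross0.
have const z : z \in v :: p -> f z = f v; last by rewrite !const.
rewrite {x y xp yp}; elim: p v cross0 z => [|x p IH] v; first by move=> _ z; rewrite inE => /eqP ->.
rewrite /crossings walk_sum_cons => /eqP; rewrite addn_eq0 => /andP[+ /eqP cross0] z.
rewrite eqb0 negbK => /eqP fvx; rewrite inE => /predU1P[-> //|zp].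
by rewrite (IH x cross0 z zp).
Qed.

End WalkSum.

(** * From tours of the completion to closed spanning walks of the graph *)

Lemma dicycle_cost_pairmap (R : realType) (V : finType) (c : V -> V -> R) x s :
  uniq (x :: s) -> dicycle_cost c (x :: s) = dipath_cost c x (rcons s x).
Proof.
move=> us; rewrite /dicycle_cost /dipath_cost (big_nth x) [RHS](big_nth (0 : R)).
rewrite size_pairmap size_rcons; rewrite big_nat [RHS]big_nat.
apply: eq_bigr => i /andP[_ ilt]; rewrite (nth_pairmap x) ?size_rcons //.
congr (c _ _).
  by rewrite -rcons_cons nth_rcons ilt.
rewrite next_nth mem_nth // index_uniq // nth_rcons.
by move: ilt; rewrite ltnS leq_eqVlt => /orP[/eqP ->|-> //]; rewrite ltnn eqxx nth_default.
Qed.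

(** Each arc is replaced by a cheapest dipath between its ends; the result may repeat vertices. *)
Lemma expand_walk (R : realType) (V : finType) (e : rel V) (c c' : V -> V -> R) v s :
  is_metric_completion e c c' -> path [rel x y | x != y] v s ->
  exists p, [/\ path e v p, last v p = last v s, {subset s <= p}
    & dipath_cost c v p = dipath_cost c' v s].
Proof.
move=> c'P; elim: s v => [|x s IH] v /=; first by exists [::]; rewrite /dipath_cost !big_nil.
move=> /andP[vx /IH[p [px lp sp cp]]].
have [[q [qv qx _] cq] _] := c'P v x vx.
exists (q ++ p); split.
- by rewrite cat_path qv qx.
- by rewrite last_cat qx.
- move=> y; rewrite inE mem_cat => /predU1P[->|/sp ->]; last by rewrite orbT.
  (* The dipath [q] is nonempty because [v != x], so its last vertex [x] occurs in it. *)
  by case: q qx {qv cq} => [/= E|z q /= <-]; rewrite ?mem_last // E eqxx in vx *.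
- rewrite /dipath_cost pairmap_cat big_cat qx /= big_cons -cq.
  by congr (_ + _).
Qed.

(** * Arithmetic of the numbers of traversals of the edges *)

Section Parity.
Variables (k m : nat) (X : 'I_k.+1 -> nat -> nat).
Hypothesis k_even : ~~ odd k.
Hypothesis X_pos : forall i j1 j2, (j1 < j2 <= m.+1)%N -> (0 < X i j1 + X i j2)%N.
Hypothesis X_even : forall i j1 j2, (j1 < j2 <= m.+1)%N -> ~~ odd (X i j1 + X i j2).
Hypothesis X0_even : ~~ odd (\sum_i X i 0).

Lemma row_ge i : (2 * m.+1 <= \sum_(j < m.+1) (X i j + X i j.+1))%N.
Proof.
rewrite mulnC -[m.+1 in leqLHS]card_ord -sum_nat_const; apply: leq_sum => j _.
have jm : (j < j.+1 <= m.+1)%N by rewrite ltnSn ltn_ord.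
by have := X_pos i jm; have := X_even i jm; lia.
Qed.

(** All entries of the row are even and at most one vanishes. Raising that one by 2 makes every
    consecutive pair sum to at least 4, and the entry occurs in at most two pairs, hence the loss of
    4. *)
Lemma even_row_ge i : ~~ odd (X i 0) -> (4 * m.+1 <= \sum_(j < m.+1) (X i j + X i j.+1) + 4)%N.
Proof.
move=> X0; have X_row j : (j <= m.+1)%N -> ~~ odd (X i j).
  by case: j => // j jm; have := X_even i (_ : 0 < j.+1 <= m.+1)%N; rewrite oddD; lia.
(* [j0] is the position of the zero entry, or an arbitrary 0 if there is none; two zeros would
   contradict [X_pos]. *)
have [j0 X_ge2] : exists j0 : nat, forall j, (j <= m.+1)%N -> (2 <= X i j + ((j == j0) + (j == j0)))%N.
  have [/existsP[j0 /eqP Xj0]|] := boolP [exists j : 'I_m.+2, X i j == 0]; last first.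
    rewrite negb_exists => /forallP X_neq0; exists 0 => j jm.
    by have := X_neq0 (Ordinal (jm : (j < m.+2)%N)); have := X_row j jm => /=; lia.
  exists (j0 : nat) => j jm; have j0m := ltn_ord j0; have := X_row j jm.
  case: (ltngtP j j0) => [jj0|jj0|->]; rewrite ?muln1 //.
    by have := X_pos i (_ : j < j0 <= m.+1)%N; rewrite Xj0; lia.
    by have := X_pos i (_ : j0 < j <= m.+1)%N; rewrite Xj0; lia.
  by rewrite leq_addl.
have one (b : nat) : (\sum_(j < m.+1) (j + b == j0) <= 1)%N.
  have [/existsP[j /eqP E]|] := boolP [exists j : 'I_m.+1, j + b == j0]%N.
    rewrite (bigD1 j) //= E eqxx big1 // => j'; rewrite -val_eqE /= => jj'.
    by apply/eqP; rewrite eqb0 -E eqn_add2r.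
  rewrite negb_exists => /forallP no; rewrite big1 // => j _.
  by rewrite (negbTE (no j)).
apply: (@leq_trans (\sum_(j < m.+1) (X i j + X i j.+1 + ((j + 0 == j0) + (j + 0 == j0)) +
    ((j + 1 == j0) + (j + 1 == j0))))%N).
  rewrite mulnC -[m.+1 in leqLHS]card_ord -sum_nat_const; apply: leq_sum => j _.
  have jm := ltn_ord j; have := X_ge2 j (ltnW jm); have := X_ge2 j.+1 jm.
  by rewrite addn0 addn1; lia.
rewrite !big_split /=.
rewrite -addnA leq_add2l; exact: leq_add (leq_add (one 0) (one 0)) (leq_add (one 1) (one 1)).
Qed.

(** An odd number [k.+1] of odd entries would have an odd sum, against [X0_even]. *)
Lemma even_row_exists : exists i, ~~ odd (X i 0).
Proof.
apply/existsP; apply: contraNT X0_even; rewrite negb_exists => /forallP X_odd.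
have -> : odd (\sum_i X i 0) = odd (\sum_(i < k.+1) 1).
  rewrite !(big_morph odd oddD (erefl _)); apply: eq_bigr => i _.
  by rewrite -[odd _]negbK X_odd.
by rewrite sum1_card card_ord /= k_even.
Qed.

(** The double sum is twice the cost of the walk. One row gives [4 * m.+1 - 4] and each of the [k]
    others at least [2 * m.+1]. *)
Lemma crossing_total_ge :
  (2 * (k.+1 * m.+1 + m.+1) <= \sum_i \sum_(j < m.+1) (X i j + X i j.+1) + 4)%N.
Proof.
have [i0 /even_row_ge i0_ge] := even_row_exists.
rewrite (bigD1 i0) //=.
have : (\sum_(i | i != i0) 2 * m.+1 <= \sum_(i | i != i0) \sum_(j < m.+1) (X i j + X i j.+1))%N.
  by apply: leq_sum => i _; apply: row_ge.
have -> : (\sum_(i | i != i0) 2 * m.+1 = k * (2 * m.+1))%N.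
  by rewrite sum_nat_const cardC1 card_ord.
move=> rest_ge; rewrite addnAC; apply: leq_trans (leq_add i0_ge rest_ge).
by lia.
Qed.

End Parity.

(** * Lower bound for closed spanning walks and tours of the theta graph *)

Section TourBound.
Variables (R : realType) (k m : nat).
Hypothesis k_even : ~~ odd k.

Notation V := 'I_(theta_order k m).
Implicit Types (i : 'I_k.+1) (u v : V).

Definition on_edge i (j : nat) u v : bool :=
  ((u, v) == walk_arc m i j true) || ((u, v) == walk_arc m i j false).

Lemma on_edgeE i (j : nat) i0 (j0 : 'I_m.+2) b u v : (j <= m.+1)%N ->
  (u, v) = walk_arc m i0 j0 b -> on_edge i j u v = (i == i0) && (j == j0).
Proof.
move=> jm; rewrite /on_edge => ->; apply/idP/andP => [|[/eqP -> /eqP ->]]; last first.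
  by case: b; rewrite eqxx ?orbT.
by move=> /orP[] /eqP /(@walk_arc_inj _ _ _ _ _ (Ordinal (jm : (j < m.+2)%N))) [-> -> _];
  rewrite !eqxx.
Qed.

Section ClosedWalk.
Variables (v0 : V) (p : seq V).
Hypotheses (p_walk : path (@theta_rel k m) v0 p) (p_closed : last v0 p = v0).
Hypothesis p_spans : forall u, u \in v0 :: p.

Let X i (j : nat) := walk_sum (on_edge i j) v0 p.

(** The vertices of row [i] in columns [j1.+1] to [j2] are all interior, so the only edges leaving
    this segment are the edges [j1] and [j2] of the row. *)
Lemma segment_crossings i (j1 j2 : nat) : (j1 < j2 <= m.+1)%N ->
  crossings (fun u => (row u == i) && (j1 < col u <= j2)%N) v0 p = (X i j1 + X i j2)%N.
Proof.
move=> /andP[j12 j2m]; set f := fun u => _.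
have fE i0 (j0 : nat) : (j0 <= m.+2)%N -> f (vtx m i0 j0) = (i0 == i) && (j1 < j0 <= j2)%N.
  move=> j0m; rewrite /f col_vtx //; have [jj|] := boolP (j1 < j0 <= j2)%N; last by rewrite !andbF.
  by rewrite row_vtx //; move: jj; lia.
rewrite -walk_sumD; apply: (eq_walk_sum p_walk) => u v /theta_relP[i0 [j0 [b uv]]].
rewrite !(on_edgeE _ _ uv) ?(leq_trans (ltnW j12)) //.
have j0m := ltn_ord j0.
have -> : (f u != f v) = (f (vtx m i0 j0) != f (vtx m i0 j0.+1)).
  by move: uv; rewrite /walk_arc; case: b => -[-> ->] //; rewrite eq_sym.
rewrite !fE ?(ltnW j0m) // [i0 == i]eq_sym.
by case: (i == i0) => //=; lia.
Qed.

(** The edges at the shared first vertex are exactly the edges 0 of the rows. *)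
Lemma apex_crossings : crossings (pred1 (vtx m (ord0 : 'I_k.+1) 0)) v0 p = (\sum_i X i 0)%N.
Proof.
rewrite -walk_sum_sum; apply: (eq_walk_sum p_walk) => u v /theta_relP[i0 [j0 [b uv]]].
rewrite (eq_bigr (fun i => (i == i0) && (0 == j0)%N : nat)); last first.
  by move=> i _; rewrite (on_edgeE _ _ uv).
rewrite (bigD1 i0) //= eqxx big1 ?addn0 => [|i /negPf -> //].
have j0m := ltn_ord j0.
have fE (j : nat) : (j <= m.+2)%N -> (vtx m i0 j == vtx m ord0 0) = (j == 0)%N.
  move=> jm; apply/eqP/eqP => [/(congr1 (@col k m))|->]; last exact: vtx_first.
  by rewrite !col_vtx.
have -> : ((u == vtx m ord0 0) != (v == vtx m ord0 0)) =
    ((vtx m i0 j0 == vtx m ord0 0) != (vtx m i0 j0.+1 == vtx m ord0 0)).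
  by move: uv; rewrite /walk_arc; case: b => -[-> ->] //; rewrite eq_sym.
by rewrite !fE ?(ltnW j0m) //; case: (nat_of_ord j0).
Qed.

(** Double counting by interior vertices: the one in column [j.+1] of a row is an endpoint of
    exactly the edges [j] and [j.+1] of that row. *)
Lemma walk_sum_interior : walk_sum (fun u v => interior u + interior v)%N v0 p =
  (\sum_i \sum_(j < m.+1) (X i j + X i j.+1))%N.
Proof.
transitivity (walk_sum (fun u v => \sum_i \sum_(j < m.+1)
    (on_edge i j u v + on_edge i j.+1 u v))%N v0 p); last first.
  rewrite walk_sum_sum; apply: eq_bigr => i _.
  by rewrite walk_sum_sum; apply: eq_bigr => j _; rewrite walk_sumD.
apply: (eq_walk_sum p_walk) => u v /theta_relP[i0 [j0 [b uv]]].
have j0m := ltn_ord j0.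
have -> : (interior u + interior v = interior (vtx m i0 j0) + interior (vtx m i0 j0.+1))%N.
  by move: uv; rewrite /walk_arc; case: b => -[-> ->] //; rewrite addnC.
rewrite !interior_vtx ?(ltnW j0m) //.
rewrite (bigD1 i0) //= [X in _ = (_ + X)%N]big1 ?addn0; last first.
  move=> i /negPf ii0; rewrite big1 // => j _; have jm := ltn_ord j.
  by rewrite !(on_edgeE _ _ uv) ?ii0 // ltnW.
rewrite (eq_bigr (fun j : 'I_m.+1 => (j == j0 :> nat) + (j.+1 == j0))%N); last first.
  by move=> j _; have jm := ltn_ord j; rewrite !(on_edgeE _ _ uv) ?eqxx // ltnW.
have count (b' : nat) : (\sum_(j < m.+1) (j + b' == j0) = (b' <= j0 < m.+1 + b'))%N.
  have [/andP[bj jb]|nb] := boolP (b' <= j0 < m.+1 + b')%N.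
    have jm : (j0 - b' < m.+1)%N by lia.
    rewrite (bigD1 (Ordinal jm)) //= subnK // eqxx big1 // => j; rewrite -val_eqE /= => jj.
    by apply/eqP; rewrite eqb0; apply: contra jj => /eqP <-; rewrite addnK.
  by rewrite big1 // => j _; have jm := ltn_ord j; apply/eqP; rewrite eqb0; move: nb; lia.
rewrite big_split /= [X in _ = (X + _)%N](_ : _ = (0 <= j0 < m.+1 + 0)%N :> nat); last first.
  by rewrite -count; apply: eq_bigr => j _; rewrite addn0.
rewrite [X in _ = (_ + X)%N](_ : _ = (1 <= j0 < m.+1 + 1)%N :> nat); last first.
  by rewrite -count; apply: eq_bigr => j _; rewrite addn1.
by rewrite addn0 addn1 j0m andbT addnC (_ : j0 <= m.+1)%N ?andbT.
Qed.

Lemma closed_walk_cost : (k.+1 * m.+1 + m.+1)%:R - 2 <= dipath_cost (@theta_cost R k m) v0 p.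
Proof.
have -> : dipath_cost (@theta_cost R k m) v0 p =
    (walk_sum (fun u v => interior u + interior v)%N v0 p)%:R / 2.
  rewrite /dipath_cost; elim: (p) (v0) => [|x q IH] v.
    by rewrite /walk_sum !big_nil mul0r.
  by rewrite walk_sum_cons /= big_cons IH /theta_cost [in RHS]natrD mulrDl.
rewrite ler_pdivlMr // mulrBl -natrM lerBlDr -natrM -natrD ler_nat mulnC walk_sum_interior.
apply: crossing_total_ge => // [i j1 j2 j12|i j1 j2 j12|].
(* The spanning walk visits [vtx i j2], inside the segment, and the end vertex [vtx i 0], outside
   it. *)
- rewrite -segment_crossings //; apply: (crossings_gt0 (p_spans (vtx m i j2)) (p_spans (vtx m i 0))).
  have /andP[j12' j2m] := j12; rewrite !col_vtx ?(leqW j2m) //= andbF eqbF_neg negbK.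
  by rewrite row_vtx ?eqxx ?j12' ?leqnn //; move: j12; lia.
- by rewrite -segment_crossings // odd_crossings p_closed eqxx.
- by rewrite -apex_crossings odd_crossings p_closed eqxx.
Qed.

End ClosedWalk.

Lemma hamiltonian_cost (c' : V -> V -> R) s :
  is_metric_completion (@theta_rel k m) (@theta_cost R k m) c' ->
  hamiltonian_dicycle s -> (k.+1 * m.+1 + m.+1)%:R - 2 <= dicycle_cost c' s.
Proof.
move=> c'P [/andP[s_cycle s_uniq] s_all].
case: s s_cycle s_uniq s_all => [|x s] s_cycle s_uniq s_all.
  by have := s_all (vtx m ord0 0).
rewrite dicycle_cost_pairmap //.
have [p [px lp sp <-]] := expand_walk c'P s_cycle.
apply: closed_walk_cost => //; first by rewrite lp last_rcons.
move=> u; rewrite inE; apply/orP; right; apply: sp.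
by rewrite mem_rcons.
Qed.

End TourBound.

(** * Choice of the parameters and the resulting ratio *)

Theorem theorem2 (R : realType) :
  exists (eps0 c1 c2 : R) (nu : nat -> R -> nat),
    [/\ 0 < eps0, 0 < c1 & 0 < c2] /\
    forall (t : nat) (eps : R), 0 < eps -> eps < eps0 ->
      (c1 * ((maxn t 1)%:R / eps) <= (nu t eps)%:R
         <= c2 * ((maxn t 1)%:R / eps)) /\
      exists (e : rel 'I_(nu t eps)) (c c' : 'I_(nu t eps) -> 'I_(nu t eps) -> R)
             (rho : R),
        [/\ irreflexive e,
            forall v w, e v w -> 0 <= c v w,
            is_metric_completion e c c',
            is_integrality_ratio t c' rho
          & 1 + (1 - eps) / (2 * t + 3)%:R <= rho].
Proof.
(* There are K = 2t+3 rows with M = [m.+1] interior vertices each, so the order is KM + 2. Since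
   [eps < 1], M is at most 3/eps; as K is at most [5 * maxn t 1], the order is at most 15 + 2 = 17
   times [maxn t 1 / eps]. *)
exists 1, 1, 17, (fun t eps => theta_order t.+1.*2 (Num.truncn (2 / eps))).
split=> [|t eps eps_gt0 eps_lt1]; first by split; rewrite ?ltr0n.
set k := t.+1.*2; set m := Num.truncn (2 / eps).
have m_itv : m%:R <= 2 / eps < m.+1%:R.
  by apply: truncn_itv; rewrite divr_ge0 // ltW.
have kE : k.+1 = (2 * t + 3)%N by rewrite /k; lia.
have eps_m : 2 <= eps * m.+1%:R.
  by case/andP: m_itv => _ /ltW; rewrite ler_pdivrMr // mulrC.
split.
  have inv_ge1 : 1 <= eps^-1 by rewrite invf_ge1 // ltW.
  rewrite theta_orderE -/k -/m kE -addn2 natrD natrM natrD natrM.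
  case/andP: m_itv => m_le m_lt; rewrite -natr1 in m_lt *.
  have [max1 [maxt max2]] : 1 <= (maxn t 1)%:R :> R /\
      (t%:R <= (maxn t 1)%:R :> R /\ (maxn t 1)%:R <= t%:R + 1 :> R).
    by rewrite natr1 ler1n !ler_nat; lia.
  have t_ge0 : 0 <= t%:R :> R by rewrite ler0n.
  by apply/andP; split; nra.
have tk : (t.+1.*2 <= k.+1)%N by rewrite leqnSn.
have k_even : ~~ odd k by rewrite /k odd_double.
have [c' c'P] := theta_completion_exists R k m.
have [opt optP] := hamiltonian_minimum_exists c'P.
have [[s s_ham s_opt] _] := optP.
have opt_ge := hamiltonian_cost k_even c'P s_ham.
exists (@theta_rel k m), (@theta_cost R k m), c', (opt / (k.+1 * m.+1)%:R); split=> //.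
- exact: theta_rel_irr.
- by move=> v w _; rewrite divr_ge0.
- by exists opt, (k.+1 * m.+1)%:R; split=> //; apply: theta_SA_minimum.
(* The ratio is at least (KM + M - 2) / (KM) = 1 + (1 - 2/M) / K, and [eps_m] says that 2/M is at
   most [eps]. *)
rewrite -kE ler_pdivlMr ?ltr0n // -s_opt (le_trans _ opt_ge) //.
rewrite natrM natrD natrM mulrDl mul1r mulrA divfK ?pnatr_eq0 //.
by lra.
Qed.
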